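(* There is a $6$-approximation algorithm for problem (iK-ds) that runs in linear time. That is, there is an algorithm which, for every instance of (iK-ds) with $n$ items, uses $O(n)$ elementary arithmetic operations and comparisons and returns a feasible solution of (iK-ds) whose profit is at least $\tfrac16$ of the optimal objective value of (iK-ds).
   Context: The single-level improvable knapsack problem with discrete weight improvements (iK-ds): there are $n$ items; item $i$ has profit $p_i\ge 0$, original weight $w_i$, improved weight $\hat{w}_i$ with $0\le \hat{w}_i\le w_i$, and improvement cost $c_i\ge 0$. There are a knapsack budget $B\ge 0$ and an improvement budget $C\ge 0$. Put $\overline{w}_i := w_i-\hat{w}_i$. The problem is $$\max \sum_{i=1}^n p_i x_i \quad\text{s.t.}\quad \sum_{i=1}^n w_i x_i-\sum_{i=1}^n \overline{w}_i y_i\le B,\quad \sum_{i=1}^n c_i y_i\le C,$$ $$y_i\le x_i,\quad x_i\in\{0,1\},\quad y_i\in\{0,1\}\quad\text{for all } i\in\{1,\ldots,n\}.$$ The profit of a solution $(x,y)$ is $\sum_{i=1}^n p_i x_i$. *)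

(* Defs.v *)
From HB Require Import structures.
From mathcomp Require Import all_boot all_order all_algebra.

Set Implicit Arguments.
Unset Strict Implicit.
Unset Printing Implicit Defensive.

Import Order.TTheory GRing.Theory Num.Theory.
Local Open Scope ring_scope.

Record iKds (R : realFieldType) (n : nat) := IKds {
  prof : 'I_n -> R;       (* p_i *)
  wgt : 'I_n -> R;        (* w_i *)
  iwgt : 'I_n -> R;       (* improved weight, w_i with a hat *)
  icost : 'I_n -> R;      (* c_i *)
  kbudget : R;            (* B *)
  ibudget : R;            (* C *)
  prof_ge0 : forall i, 0 <= prof i;
  iwgt_bounds : forall i, 0 <= iwgt i <= wgt i;
  icost_ge0 : forall i, 0 <= icost i;
  kbudget_ge0 : 0 <= kbudget;
  ibudget_ge0 : 0 <= ibudget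
}.

Section Problem.
Variables (R : realFieldType) (n : nat) (I : iKds R n).
Implicit Types x y : {ffun 'I_n -> bool}.

Definition weight_gain (i : 'I_n) : R := wgt I i - iwgt I i.

Definition feasible x y : bool :=
  [&& \sum_i wgt I i * (x i)%:R - \sum_i weight_gain i * (y i)%:R <= kbudget I,
      \sum_i icost I i * (y i)%:R <= ibudget I
    & [forall i, (y i <= x i)%N]].

Definition profit x : R := \sum_i prof I i * (x i)%:R.

(* The default value 0 is the profit of the all-zero solution, which is always
   feasible, and profits are nonnegative: this is the true maximum. *)
Definition opt : R :=
  \big[Num.max/0]_(s : {ffun 'I_n -> bool} * {ffun 'I_n -> bool}
                    | feasible s.1 s.2) profit s.1.

End Problem.

(* Algorithms are programs of a first-order, call-by-value language on exact numbers and
   lists. A program is a finite text that mentions neither the instance, nor its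
   size, nor the number field. Every expression evaluated counts for one step,
   so that the number of steps bounds the number of arithmetic operations, of
   comparisons, and of all other operations (list accesses, function calls).
   Function bodies do not see the environment of their caller, hence the size of
   an environment is bounded by the text of the program and each step is a
   constant-time operation of a real RAM. The numbers can only be inspected by
   comparisons; in particular there is no rounding. *)

Inductive arith_op := Add | Sub | Mul | Div.

Inductive expr :=
  | EVar of nat                          (* de Bruijn index *)
  | ENum of nat                          (* numeral *)
  | EOp of arith_op & expr & expr
  | EIfLe of expr & expr & expr & expr   (* if e1 <= e2 then e3 else e4 *)
  | ENil
  | ECons of expr & expr
  | EMatch of expr & expr & expr         (* e3 binds the head as 0, the tail as 1 *)
  | ELet of expr & expr
  | ECall of nat & expr.

(* [ECall k] refers to the [k]-th function; all functions are unary and may be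
   mutually recursive. *)
Record program := Program { funs : seq expr; main : expr }.

Inductive val (R : Type) :=
  | VNum of R
  | VNil
  | VCons of val R & val R.
Arguments VNil {R}.

(* Division by zero gets stuck. *)
Definition arith (R : realFieldType) (o : arith_op) (a b : R) : option R :=
  match o with
  | Add => Some (a + b)
  | Sub => Some (a - b)
  | Mul => Some (a * b)
  | Div => if b == 0 then None else Some (a / b)
  end.

(* [eval fs env e v t]: in environment [env], [e] evaluates to [v] in [t] steps. *)
Inductive eval (R : realFieldType) (fs : seq expr) :
    seq (val R) -> expr -> val R -> nat -> Prop :=
  | eval_var env k v :
      onth env k = Some v -> eval fs env (EVar k) v 1
  | eval_num env k :
      eval fs env (ENum k) (VNum k%:R) 1
  | eval_op env o e1 e2 a b c t1 t2 :
      eval fs env e1 (VNum a) t1 -> eval fs env e2 (VNum b) t2 ->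
      arith o a b = Some c ->
      eval fs env (EOp o e1 e2) (VNum c) (t1 + t2).+1
  | eval_if env e1 e2 e3 e4 a b v t1 t2 t3 :
      eval fs env e1 (VNum a) t1 -> eval fs env e2 (VNum b) t2 ->
      eval fs env (if a <= b then e3 else e4) v t3 ->
      eval fs env (EIfLe e1 e2 e3 e4) v (t1 + t2 + t3).+1
  | eval_nil env :
      eval fs env ENil VNil 1
  | eval_cons env e1 e2 v1 v2 t1 t2 :
      eval fs env e1 v1 t1 -> eval fs env e2 v2 t2 ->
      eval fs env (ECons e1 e2) (VCons v1 v2) (t1 + t2).+1
  | eval_match_nil env e1 e2 e3 v t1 t2 :
      eval fs env e1 VNil t1 -> eval fs env e2 v t2 ->
      eval fs env (EMatch e1 e2 e3) v (t1 + t2).+1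
  | eval_match_cons env e1 e2 e3 v1 v2 v t1 t2 :
      eval fs env e1 (VCons v1 v2) t1 ->
      eval fs [:: v1, v2 & env] e3 v t2 ->
      eval fs env (EMatch e1 e2 e3) v (t1 + t2).+1
  | eval_let env e1 e2 v1 v t1 t2 :
      eval fs env e1 v1 t1 -> eval fs (v1 :: env) e2 v t2 ->
      eval fs env (ELet e1 e2) v (t1 + t2).+1
  | eval_call env k e body v1 v t1 t2 :
      eval fs env e v1 t1 -> onth fs k = Some body ->
      eval fs [:: v1] body v t2 ->
      eval fs env (ECall k e) v (t1 + t2).+1.

Lemma eval_det (R : realFieldType) fs (env : seq (val R)) e v t v' t' :
  eval fs env e v t -> eval fs env e v' t' -> v = v' /\ t = t'.
Proof.
move=> ev; elim: ev v' t' => {env e v t}.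
- by move=> env k v kv v' t' ev'; inversion ev'; split; congruence.
- by move=> env k v' t' ev'; inversion ev'.
- move=> env o e1 e2 a b c t1 t2 _ IH1 _ IH2 abc v' t' ev'; inversion ev'; subst.
  have [[?] ?] := IH1 _ _ ltac:(eassumption).
  have [[?] ?] := IH2 _ _ ltac:(eassumption).
  by subst; split; congruence.
- move=> env e1 e2 e3 e4 a b v t1 t2 t3 _ IH1 _ IH2 _ IH3 v' t' ev'.
  inversion ev'; subst.
  have [[?] ?] := IH1 _ _ ltac:(eassumption).
  have [[?] ?] := IH2 _ _ ltac:(eassumption); subst.
  by have [? ?] := IH3 _ _ ltac:(eassumption); subst.
- by move=> env v' t' ev'; inversion ev'.
- move=> env e1 e2 v1 v2 t1 t2 _ IH1 _ IH2 v' t' ev'; inversion ev'; subst.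
  have [? ?] := IH1 _ _ ltac:(eassumption).
  by have [? ?] := IH2 _ _ ltac:(eassumption); subst.
- move=> env e1 e2 e3 v t1 t2 _ IH1 _ IH2 v' t' ev'; inversion ev'; subst;
    have [// ? ?] := IH1 _ _ ltac:(eassumption).
  by have [? ?] := IH2 _ _ ltac:(eassumption); subst.
- move=> env e1 e2 e3 v1 v2 v t1 t2 _ IH1 _ IH2 v' t' ev'; inversion ev'; subst;
    have [// [? ?] ?] := IH1 _ _ ltac:(eassumption); subst.
  by have [? ?] := IH2 _ _ ltac:(eassumption); subst.
- move=> env e1 e2 v1 v t1 t2 _ IH1 _ IH2 v' t' ev'; inversion ev'; subst.
  have [? ?] := IH1 _ _ ltac:(eassumption); subst.
  by have [? ?] := IH2 _ _ ltac:(eassumption); subst.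
- move=> env k e body v1 v t1 t2 _ IH1 kb _ IH2 v' t' ev'.
  inversion ev' as [| | | | | | | | |env' k' e' body' u1 u s1 s2 eu kb' eu']; subst.
  have [? ?] := IH1 _ _ eu; subst.
  by move: eu'; have -> : body' = body by [congruence] => /IH2 [? ?]; subst.
Qed.

(* [runs A u v t]: on input [u], program [A] returns [v] after [t] steps. *)
Definition runs (R : realFieldType) (A : program) (u v : val R) (t : nat) : Prop :=
  eval (funs A) [:: u] (main A) v t.

Definition vlist (R : Type) (s : seq (val R)) : val R :=
  foldr (@VCons R) VNil s.

Definition encode_item (R : realFieldType) (n : nat) (I : iKds R n) (i : 'I_n) :
    val R :=
  vlist [:: VNum (prof I i); VNum (wgt I i); VNum (iwgt I i); VNum (icost I i)].

Definition encode_instance (R : realFieldType) (n : nat) (I : iKds R n) : val R :=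
  vlist [:: VNum (kbudget I); VNum (ibudget I);
            vlist [seq encode_item I i | i <- enum 'I_n]].

Definition encode_solution (R : realFieldType) (n : nat)
    (x y : {ffun 'I_n -> bool}) : val R :=
  vlist [seq vlist [:: VNum (x i)%:R; VNum (y i)%:R] | i <- enum 'I_n].
Arguments encode_solution R {n} x y.

(* Main.v *)
Require Import Defs.
From HB Require Import structures.
From mathcomp Require Import all_boot all_order all_algebra.
From mathcomp Require Import zify ring lra.

Set Implicit Arguments.
Unset Strict Implicit.
Unset Printing Implicit Defensive.

Import Order.TTheory GRing.Theory Num.Theory.
Local Open Scope ring_scope.

(** Measure the weight in units of the knapsack budget [B] and the cost in units
    of the improvement budget [C], and let the size of a chosen item be the sum
    of the shares of both budgets that it uses. Each item that fits in some way
    is chosen, improved or not, in the way that makes its size [s] smaller. Then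
    a set of items of total size at most 1 is feasible, and so is a single item
    of size at most 2, since it respects each budget separately. Conversely, a
    feasible solution uses each budget at most once, hence has total size at most
    2. The two-budget problem is thereby compared with ordinary knapsacks of
    capacities 1 and 2.

    For a density [lam >= 0] write [excess lam] for the sum of the positive parts
    of [p i - lam * s i]. Weak Lagrangian duality gives
    [opt <= excess lam + 2 * lam <= 2 * F] with [F := lam + excess lam]
    ([opt_le]). Let [lam] be the critical density of capacity 1: the items of
    density above [lam] have total size at most 1, and those of density at least
    [lam] exceed it, or [lam = 0]. If some item has [2 * p i > F], it alone is a
    solution worth a quarter of [opt]. Otherwise take all items above [lam], then
    items of density exactly [lam] as long as they fit; the profit is
    [excess lam + lam * (used size)]. Either the used size reaches 1, or an item
    of density [lam] was rejected, and that item together with the used size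
    exceeds 1 ([fill_maximal]); as its profit is at most [F / 2], the solution is
    worth at least [F / 2], again a quarter of [opt]. So the algorithm is even a
    4-approximation.

    The critical density is found in linear time by weighted selection
    ([sel_spec]). The pivot is the median of the medians of three medians of
    three; it is found by a recursive call on a ninth of the list, and discards
    two ninths of it (up to rounding). Since 1/9 + 7/9 < 1, the recursion is linear
    ([sel_cost]). A single function serves for both purposes, because the
    median is a weighted selection with unit weights.

    The program is a list of first-order functions. For each of them, a [_spec]
    lemma gives its value as a function on lists and a linear bound on
    its number of steps. *)

(** * Evaluation with an upper bound on the number of steps *)

(* By itself, [val] denotes the injection of a subtype. *)
Notation value := Defs.val.

(** Bounds instead of exact step counts make the rules below composable: the
    two branches of a test need not take equally long. *)
Definition evalb (R : realFieldType) (fs : seq expr) (env : seq (value R)) e v (T : nat) : Prop :=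
  exists2 t, eval fs env e v t & (t <= T)%N.

Section Rules.
Variables (R : realFieldType) (fs : seq expr).
Implicit Types (env : seq (value R)) (v : value R).

Lemma evalb_le env e v T T' : evalb fs env e v T -> (T <= T')%N -> evalb fs env e v T'.
Proof. by case=> t ev le_t le_T; exists t => //; apply: leq_trans le_T. Qed.

Lemma evalb_var env k v : onth env k = Some v -> evalb fs env (EVar k) v 1.
Proof. by move=> kv; exists 1%N => //; constructor. Qed.

Lemma evalb_num env k : evalb fs env (ENum k) (VNum k%:R) 1.
Proof. by exists 1%N => //; constructor. Qed.

Lemma evalb_nil env : evalb fs env ENil VNil 1.
Proof. by exists 1%N => //; constructor. Qed.

Lemma evalb_op env o e1 e2 a b c T1 T2 :
  evalb fs env e1 (VNum a) T1 -> evalb fs env e2 (VNum b) T2 ->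
  arith o a b = Some c -> evalb fs env (EOp o e1 e2) (VNum c) (T1 + T2).+1.
Proof.
move=> [t1 ev1 le1] [t2 ev2 le2] oab; exists (t1 + t2).+1; last by rewrite ltnS leq_add.
exact: eval_op ev1 ev2 oab.
Qed.

Lemma evalb_if env e1 e2 e3 e4 a b v T1 T2 T3 :
  evalb fs env e1 (VNum a) T1 -> evalb fs env e2 (VNum b) T2 ->
  evalb fs env (if a <= b then e3 else e4) v T3 ->
  evalb fs env (EIfLe e1 e2 e3 e4) v (T1 + T2 + T3).+1.
Proof.
move=> [t1 ev1 le1] [t2 ev2 le2] [t3 ev3 le3].
exists (t1 + t2 + t3).+1; last by rewrite ltnS !leq_add.
exact: eval_if ev1 ev2 ev3.
Qed.

Lemma evalb_cons env e1 e2 v1 v2 T1 T2 :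
  evalb fs env e1 v1 T1 -> evalb fs env e2 v2 T2 ->
  evalb fs env (ECons e1 e2) (VCons v1 v2) (T1 + T2).+1.
Proof.
move=> [t1 ev1 le1] [t2 ev2 le2]; exists (t1 + t2).+1; last by rewrite ltnS leq_add.
exact: eval_cons.
Qed.

(** One rule for both shapes of the scrutinee, so that the shape need not be
    known before the scrutinee has been evaluated. *)
Lemma evalb_match env e1 e2 e3 u v T1 T2 :
  evalb fs env e1 u T1 ->
  match u with
  | VNum _ => False
  | VNil => evalb fs env e2 v T2
  | VCons u1 u2 => evalb fs [:: u1, u2 & env] e3 v T2
  end -> evalb fs env (EMatch e1 e2 e3) v (T1 + T2).+1.
Proof.
case: u => [//||u1 u2] [t1 ev1 le1] [t2 ev2 le2];
  (exists (t1 + t2).+1; last by rewrite ltnS leq_add).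
- exact: eval_match_nil.
- exact: eval_match_cons ev1 ev2.
Qed.

Lemma evalb_let env e1 e2 v1 v T1 T2 :
  evalb fs env e1 v1 T1 -> evalb fs (v1 :: env) e2 v T2 ->
  evalb fs env (ELet e1 e2) v (T1 + T2).+1.
Proof.
move=> [t1 ev1 le1] [t2 ev2 le2]; exists (t1 + t2).+1; last by rewrite ltnS leq_add.
exact: eval_let ev1 ev2.
Qed.

Lemma evalb_call env k e body v1 v T1 T2 :
  evalb fs env e v1 T1 -> onth fs k = Some body -> evalb fs [:: v1] body v T2 ->
  evalb fs env (ECall k e) v (T1 + T2).+1.
Proof.
move=> [t1 ev1 le1] kb [t2 ev2 le2]; exists (t1 + t2).+1; last by rewrite ltnS leq_add.
exact: eval_call ev1 kb ev2.
Qed.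

End Rules.

(** * The program *)

(** Programs know functions by their position only; these are the positions in
    [knap_funs]. *)
Notation call_share := (ECall 0).
Notation call_prep := (ECall 1).
Notation call_cands := (ECall 2).
Notation call_above := (ECall 3).
Notation call_below := (ECall 4).
Notation call_wsum := (ECall 5).
Notation call_med3s := (ECall 6).
Notation call_sel := (ECall 7).
Notation call_excess := (ECall 8).
Notation call_zeros := (ECall 9).
Notation call_single := (ECall 10).
Notation call_fill := (ECall 11).

(** Pairs are encoded by [ECons], so the [ENil] branch is never reached. *)
Notation EUnpair e e' := (EMatch e ENil e').

(* In the functions below, the comments list the variables of the environment
   from index 0 on, as far as they are used. *)

(** Argument [(a, b)], with [b >= 0]. *)
Definition share_fun : expr :=
  EUnpair (EVar 0)
    (* environment: a, b *)
    (EIfLe (EVar 0) (EVar 1)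
       (EIfLe (EVar 1) (ENum 0) (ENum 0) (EOp Div (EVar 0) (EVar 1)))
       (ENum 3)).

(** Argument [(B, (C, items))]; an item becomes [(profit, (size, improved))]. *)
Definition prep_fun : expr :=
  EUnpair (EVar 0) (EUnpair (EVar 1)
    (EMatch (EVar 1) ENil
      (EUnpair (EVar 0)
      (EUnpair (EVar 1)
      (EUnpair (EVar 1)
      (EUnpair (EVar 1)
      (* environment: c, _, iw, _, w, _, p, _, item, rest, C, items, B *)
      (ELet (call_share (ECons (EVar 4) (EVar 12)))
      (ELet (EOp Add (call_share (ECons (EVar 3) (EVar 13)))
                     (call_share (ECons (EVar 1) (EVar 11))))
      (ELet (call_prep (ECons (EVar 14) (ECons (EVar 12) (EVar 11))))
      (EUnpair (EIfLe (EVar 2) (EVar 1) (ECons (EVar 2) (ENum 0)) (ECons (EVar 1) (ENum 1)))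
      (* environment: s, y, rec, sI, sN, c, _, iw, _, w, _, p *)
      (ECons (ECons (EIfLe (EVar 0) (ENum 2) (EVar 11) (ENum 0))
                    (ECons (EVar 0) (EVar 1)))
             (EVar 2)))))))))))).

Definition cands_fun : expr :=
  EMatch (EVar 0) ENil
  (EUnpair (EVar 0) (EUnpair (EVar 1)
  (* environment: s, y, p, _, item, rest *)
  (ELet (call_cands (EVar 5))
  (EIfLe (EVar 1) (ENum 0) (EVar 0)
    (ECons (ECons (EOp Div (EVar 3) (EVar 1)) (EVar 1)) (EVar 0)))))).

(** Argument [(d, l)], with [l] a list of pairs [(key, weight)]. *)
Definition above_fun : expr :=
  EUnpair (EVar 0) (EMatch (EVar 1) ENil (EUnpair (EVar 0)
  (* environment: k, w, x, rest, d *)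
  (ELet (call_above (ECons (EVar 4) (EVar 3)))
  (EIfLe (EVar 1) (EVar 5) (EVar 0) (ECons (EVar 3) (EVar 0)))))).

Definition below_fun : expr :=
  EUnpair (EVar 0) (EMatch (EVar 1) ENil (EUnpair (EVar 0)
  (* environment: k, w, x, rest, d *)
  (ELet (call_below (ECons (EVar 4) (EVar 3)))
  (EIfLe (EVar 5) (EVar 1) (EVar 0) (ECons (EVar 3) (EVar 0)))))).

Definition wsum_fun : expr :=
  EMatch (EVar 0) (ENum 0) (EUnpair (EVar 0) (EOp Add (EVar 1) (call_wsum (EVar 3)))).

Definition med3s_fun : expr :=
  EMatch (EVar 0) ENil (EMatch (EVar 1) ENil (EMatch (EVar 1) ENil
  (* environment: z, l3, y, l2, x *)
  (EUnpair (EVar 4) (EUnpair (EVar 4) (EUnpair (EVar 4)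
  (* environment: kz, _, ky, _, kx, _, z, l3 *)
  (ECons (ECons
    (EIfLe (EVar 4) (EVar 2)
      (EIfLe (EVar 2) (EVar 0) (EVar 2) (EIfLe (EVar 4) (EVar 0) (EVar 0) (EVar 4)))
      (EIfLe (EVar 4) (EVar 0) (EVar 4) (EIfLe (EVar 2) (EVar 0) (EVar 0) (EVar 2))))
    (ENum 1))
    (call_med3s (EVar 7)))))))).

(** Expects [m], [c] and [l] in the environment, where [m] is [l] thinned
    twice by taking medians of three. *)
Definition pivot_expr : expr :=
  EMatch (EVar 0)
    (EUnpair (EVar 2) (EUnpair (EVar 0) (EVar 0)))
    (call_sel (ECons (EOp Div (call_wsum (EVar 2)) (ENum 2)) (EVar 2))).

(** Argument [(c, l)]. *)
Definition sel_fun : expr :=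
  EUnpair (EVar 0)
  (ELet (call_med3s (call_med3s (EVar 1)))
  (* environment: m, c, l *)
  (ELet pivot_expr
  (ELet (call_above (ECons (EVar 0) (EVar 3)))
  (* environment: hi, d, m, c, l *)
  (EIfLe (call_wsum (EVar 0)) (EVar 3)
    (ELet (call_below (ECons (EVar 1) (EVar 4)))
    (* environment: lo, hi, d, m, c, l *)
    (ELet (EOp Defs.Sub (call_wsum (EVar 5)) (call_wsum (EVar 0)))
      (* environment: g, lo, hi, d, m, c, l *)
      (EIfLe (EVar 0) (EVar 5)
        (call_sel (ECons (EOp Defs.Sub (EVar 5) (EVar 0)) (EVar 1)))
        (EVar 3))))
    (call_sel (ECons (EVar 3) (EVar 0))))))).

(** Argument [(lam, items)]. *)
Definition excess_fun : expr :=
  EUnpair (EVar 0) (EMatch (EVar 1) (ENum 0)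
  (EUnpair (EVar 0) (EUnpair (EVar 1)
  (* environment: s, y, p, _, item, rest, lam *)
  (ELet (EOp Mul (EVar 6) (EVar 0))
  (* environment: v, s, y, p, _, item, rest, lam *)
  (EOp Add (EIfLe (EVar 3) (EVar 0) (ENum 0) (EOp Defs.Sub (EVar 3) (EVar 0)))
           (call_excess (ECons (EVar 7) (EVar 6)))))))).

Definition out0 : expr := ECons (ENum 0) (ECons (ENum 0) ENil).

Definition zeros_fun : expr :=
  EMatch (EVar 0) ENil (ECons out0 (call_zeros (EVar 1))).

(** Argument [(F, items)]. *)
Definition single_fun : expr :=
  EUnpair (EVar 0) (EMatch (EVar 1) ENil
  (EUnpair (EVar 0) (EUnpair (EVar 1)
  (* environment: s, y, p, _, item, rest, F *)
  (EIfLe (EOp Add (EVar 2) (EVar 2)) (EVar 6)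
    (ELet (call_single (ECons (EVar 6) (EVar 5)))
      (EMatch (EVar 0) ENil (ECons out0 (EVar 2))))
    (ECons (ECons (ENum 1) (ECons (EVar 1) ENil)) (call_zeros (EVar 5))))))).

(** Argument [(lam, (r, items))]. *)
Definition fill_fun : expr :=
  EUnpair (EVar 0) (EUnpair (EVar 1) (EMatch (EVar 1) ENil
  (* environment: item, rest, r, l, lam *)
  (EUnpair (EVar 0) (EUnpair (EVar 1)
  (* environment: s, y, p, _, item, rest, r, l, lam *)
  (ELet (EOp Mul (EVar 8) (EVar 0))
  (* environment: v, s, y, p, _, item, rest, r, l, lam *)
  (let skip := ECons out0 (call_fill (ECons (EVar 9) (ECons (EVar 7) (EVar 6)))) in
   let take r := ECons (ECons (ENum 1) (ECons (EVar 2) ENil))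
                   (call_fill (ECons (EVar 9) (ECons r (EVar 6)))) in
   EIfLe (EVar 3) (EVar 0)
     (EIfLe (EVar 0) (EVar 3)
        (EIfLe (EVar 1) (EVar 7) (take (EOp Defs.Sub (EVar 7) (EVar 1))) skip)
        skip)
     (take (EVar 7)))))))).

Definition main_expr : expr :=
  EUnpair (EVar 0) (EUnpair (EVar 1) (EUnpair (EVar 1)
  (* environment: items, _, C, _, B *)
  (ELet (call_prep (ECons (EVar 4) (ECons (EVar 2) (EVar 0))))
  (ELet (ECons (ECons (ENum 0) (ENum 2)) (call_cands (EVar 0)))
  (ELet (call_sel (ECons (ENum 1) (EVar 0)))
  (* environment: lam, cs, pre *)
  (ELet (call_single (ECons (EOp Add (EVar 0) (call_excess (ECons (EVar 0) (EVar 2)))) (EVar 2)))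
  (* environment: sg, lam, cs, pre *)
  (EMatch (EVar 0)
    (call_fill (ECons (EVar 1)
      (ECons (EOp Defs.Sub (ENum 1) (call_wsum (call_above (ECons (EVar 1) (EVar 2))))) (EVar 3))))
    (EVar 2)))))))).

Definition knap_funs : seq expr :=
  [:: share_fun; prep_fun; cands_fun; above_fun; below_fun; wsum_fun; med3s_fun; sel_fun;
      excess_fun; zeros_fun; single_fun; fill_fun].

Definition enc_pair (R : realFieldType) (x : R * R) : value R :=
  VCons (VNum x.1) (VNum x.2).

Create HintDb evaldb.

(** Symbolic execution: the outcome of each test must be among the hypotheses, as
   an equation between booleans, and the callees must be specified by a
   hypothesis or in [evaldb]. The values and the step counts are existential
   variables that the rules instantiate. *)
Ltac ev :=
  lazymatch goal with
  | |- evalb _ _ (EVar _) _ _ => eapply evalb_var; reflexivity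
  | |- evalb _ _ (ENum _) _ _ => eapply evalb_num
  | |- evalb _ _ ENil _ _ => eapply evalb_nil
  | |- evalb _ _ (EOp _ _ _) _ _ =>
      eapply evalb_op; [ev | ev | rewrite /arith; try (match goal with H : (_ == 0) = false |- _ => rewrite H end); reflexivity]
  | |- evalb _ _ (EIfLe _ _ _ _) _ _ =>
      eapply evalb_if; [ev | ev | match goal with H : (_ <= _) = _ |- _ => rewrite H end; ev]
  | |- evalb _ _ (ECons _ _) _ _ => eapply evalb_cons; [ev | ev]
  | |- evalb _ _ (EMatch _ _ _) _ _ => eapply evalb_match; [ev | cbn [vlist foldr map enc_pair fst snd]; ev]
  | |- evalb _ _ (ELet _ _) _ _ => eapply evalb_let; [ev | ev]
  | |- evalb _ _ (ECall _ _) _ _ => eapply evalb_call; [ev | reflexivity | solve [eassumption | eauto 2 with evaldb nocore]]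
  | |- _ => idtac
  end.

(** * Weighted selection in linear time *)

Lemma seq3_ind (T : Type) (P : seq T -> Prop) :
  (forall l, (size l < 3)%N -> P l) ->
  (forall x y z l, P l -> P [:: x, y, z & l]) -> forall l, P l.
Proof.
move=> P0 PS l; have [n] := ubnP (size l); elim: n l => // n IH [|x [|y [|z l]]] sz;
  try exact: P0.
by apply: PS; apply: IH; move: sz => /=; lia.
Qed.

Section Specs.
Variable R : realFieldType.
Implicit Types l : seq (R * R).

Local Notation evb := (evalb (R := R) knap_funs).

Local Notation enc l := (vlist (map (@enc_pair R) l)).

Definition above (d : R) l : seq (R * R) := [seq x : R * R <- l | d < x.1].
Definition below (d : R) l : seq (R * R) := [seq x : R * R <- l | x.1 < d].

Lemma above_spec d l :
  evb [:: VCons (VNum d) (enc l)] above_fun (enc (above d l)) (18 * size l + 10).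
Proof.
elim: l => [|[k w] l IH]; first by eapply evalb_le; [rewrite /above_fun; ev|].
rewrite /above /= ltNge -/(above d l); case kd: (k <= d) => /=;
  by (eapply evalb_le; [rewrite /above_fun; ev|simpl; lia]).
Qed.

Lemma below_spec d l :
  evb [:: VCons (VNum d) (enc l)] below_fun (enc (below d l)) (18 * size l + 10).
Proof.
elim: l => [|[k w] l IH]; first by eapply evalb_le; [rewrite /below_fun; ev|].
rewrite /below /= ltNge -/(below d l); case kd: (d <= k) => /=;
  by (eapply evalb_le; [rewrite /below_fun; ev|simpl; lia]).
Qed.

Lemma wsum_spec l :
  evb [:: enc l] wsum_fun (VNum (\sum_(x <- l) x.2)) (8 * size l + 3).
Proof.
elim: l => [|[k w] l IH].
  by rewrite big_nil; eapply evalb_le; [rewrite /wsum_fun; ev|].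
by rewrite big_cons; eapply evalb_le; [rewrite /wsum_fun; ev|simpl; lia].
Qed.

Definition med3 (a b c : R) : R :=
  if a <= b then if b <= c then b else if a <= c then c else a
  else if a <= c then a else if b <= c then c else b.

Fixpoint med3s l : seq (R * R) :=
  if l is [:: x, y, z & l'] then (med3 x.1 y.1 z.1, 1) :: med3s l' else [::].

Lemma med3s_spec l : evb [:: enc l] med3s_fun (enc (med3s l)) (10 * size l + 10).
Proof.
elim/seq3_ind: l => [l sl|[k1 w1] [k2 w2] [k3 w3] l IH].
  move: l sl => [|? [|? [|? ?]]] //= _;
    by (eapply evalb_le; [rewrite /med3s_fun; ev|simpl; lia]).
rewrite /= /med3 /=.
case k12: (k1 <= k2); case k13: (k1 <= k3); case k23: (k2 <= k3);
  by (eapply evalb_le; [rewrite /med3s_fun; ev|simpl; lia]).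
Qed.

Hint Resolve above_spec below_spec wsum_spec med3s_spec : evaldb.

(** If the median of three satisfies a monotone predicate, then so do two of the
    three: every median that is counted on the left accounts for two elements
    of the list. Two rounds of medians thus account for four. *)
Lemma count_med3s (P : pred R) l :
  (forall a b c, 2 * P (med3 a b c) <= P a + P b + P c)%N ->
  (2 * count (P \o fst) (med3s l) <= count (P \o fst) l)%N.
Proof.
move=> P_med; elim/seq3_ind: l => [[|? [|? [|? ?]]] //|x y z l IH] /=.
by have := P_med x.1 y.1 z.1; lia.
Qed.

Lemma count_med3s_ge (d : R) l :
  (2 * count (fun x : R * R => (d <= x.1)%R) (med3s l) <= count (fun x : R * R => (d <= x.1)%R) l)%N.
Proof.
apply: (count_med3s (P := fun k => (d <= k)%R)) => a b c; rewrite /med3.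
case: (lerP a b) => ab; case: (lerP a c) => ac; case: (lerP b c) => bc;
  by case da: (d <= a); case db: (d <= b); case dc: (d <= c) => //; lra.
Qed.

Lemma count_med3s_le (d : R) l :
  (2 * count (fun x : R * R => (x.1 <= d)%R) (med3s l) <= count (fun x : R * R => (x.1 <= d)%R) l)%N.
Proof.
apply: (count_med3s (P := fun k => (k <= d)%R)) => a b c; rewrite /med3.
case: (lerP a b) => ab; case: (lerP a c) => ac; case: (lerP b c) => bc;
  by case da: (a <= d); case db: (b <= d); case dc: (c <= d) => //; lra.
Qed.

Lemma size_med3s l : size (med3s l) = (size l %/ 3)%N.
Proof.
elim/seq3_ind: l => [[|? [|? [|? ?]]] //|x y z l /= ->].
by rewrite (divnMDl 1 (size l) (isT : 0 < 3)%N).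
Qed.

Lemma med3s_weights (P : pred R) l :
  \sum_(x <- med3s l | P x.1) x.2 = (count (P \o fst) (med3s l))%:R.
Proof.
elim/seq3_ind: l => [[|? [|? [|? ?]]] //|x y z l IH]; rewrite ?big_nil //.
by rewrite /= big_cons /= IH; case: (P _); rewrite ?add0n // natrD.
Qed.

Definition nonneg l := forall x, x \in l -> 0 <= x.2.

Lemma nonneg_filter P l : nonneg l -> nonneg (filter P l).
Proof. by move=> l0 x; rewrite mem_filter => /andP[_ /l0]. Qed.

Lemma ler_weights (P Q : pred (R * R)) l :
  nonneg l -> (forall x, P x -> Q x) ->
  \sum_(x <- l | P x) x.2 <= \sum_(x <- l | Q x) x.2.
Proof.
move=> l0 PQ; rewrite big_mkcond [leRHS]big_mkcond big_seq [leRHS]big_seq.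
apply: ler_sum => x /l0 x0; case Px: (P x); first by rewrite PQ.
by case: ifP.
Qed.

(** When the part above the pivot [d] weighs more than [c], the threshold of
    that part is the threshold of the whole list: it cannot lie below [d], so
    the discarded keys are all smaller. *)
Lemma above_cut d c l :
  nonneg l -> c < \sum_(x <- l | d < x.1) x.2 ->
  forall d', \sum_(x <- l | (d < x.1) && (d' < x.1)) x.2 <= c ->
     c < \sum_(x <- l | (d < x.1) && (d' <= x.1)) x.2 ->
  \sum_(x <- l | d' < x.1) x.2 <= c < \sum_(x <- l | d' <= x.1) x.2.
Proof.
move=> l0 c_lt d' gt_d' ge_d'.
have dd' : d <= d'.
  rewrite leNgt; apply/negP => d'd; move: gt_d'; apply/negP; rewrite -ltNge.
  apply: lt_le_trans c_lt _; apply: ler_weights => // x dx.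
  by rewrite dx (lt_trans d'd).
apply/andP; split.
  apply: le_trans gt_d'; apply: ler_weights => // x d'x.
  by rewrite d'x andbT (le_lt_trans dd').
by apply: lt_le_trans ge_d' _; apply: ler_weights => // x /andP[].
Qed.

(** When the keys from [d] on weigh [g <= c], the threshold is sought in the
    remaining part, with [g] subtracted from the capacity. *)
Lemma below_cut d c l (g := \sum_(x <- l) x.2 - \sum_(x <- l | x.1 < d) x.2) :
  nonneg l -> g <= c ->
  forall d', \sum_(x <- l | (x.1 < d) && (d' < x.1)) x.2 <= c - g ->
     c - g < \sum_(x <- l | (x.1 < d) && (d' <= x.1)) x.2 ->
  \sum_(x <- l | d' < x.1) x.2 <= c < \sum_(x <- l | d' <= x.1) x.2.
Proof.
move=> l0 g_le d' gt_d' ge_d'.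
have gE : g = \sum_(x <- l | d <= x.1) x.2.
  rewrite /g (bigID (fun x => x.1 < d)) /= addrC addrK.
  by apply: eq_bigl => x; rewrite -leNgt.
have d'd : d' < d.
  rewrite ltNge; apply/negP => dd'; move: ge_d'; apply/negP; rewrite -leNgt.
  rewrite big_pred0 ?subr_ge0 // => x; apply/negP => /andP[xd d'x].
  by have := lt_le_trans xd (le_trans dd' d'x); rewrite ltxx.
have split_at (Q : pred R) : \sum_(x <- l | Q x.1) x.2 =
    \sum_(x <- l | (x.1 < d) && Q x.1) x.2 + \sum_(x <- l | (d <= x.1) && Q x.1) x.2.
  rewrite (bigID (fun x => x.1 < d)) /=; congr (_ + _); apply: eq_bigl => x;
    by rewrite 1?leNgt andbC.
apply/andP; split.
  rewrite (split_at (fun k => d' < k)) -(subrK g c); apply: lerD => //; rewrite gE.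
  by apply: ler_weights => // x /andP[].
rewrite (split_at (fun k => d' <= k)) -(subrK g c); apply: ltr_leD => //; rewrite gE.
by apply: ler_weights => // x dx; rewrite dx (le_trans (ltW d'd)).
Qed.

(** The pivot. With fewer than nine elements there is no median of medians, and
    the first key is used: progress by one element is enough there. The
    hypothesis is the specification of the recursive call. *)
Lemma pivot_spec K (c : R) l :
  (forall (c' : R) l', (size l' < size l)%N -> nonneg l' -> 0 <= c' < \sum_(x <- l') x.2 ->
     exists d, [/\ evb [:: VCons (VNum c') (enc l')] sel_fun (VNum d) (K * size l'),
       \sum_(x <- l' | d < x.1) x.2 <= c' & c' < \sum_(x <- l' | d <= x.1) x.2]) ->
  (0 < size l)%N ->
  exists d, [/\ forall env, evb [:: enc (med3s (med3s l)), VNum c, enc l & env]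
       pivot_expr (VNum d) (K * (size l %/ 9) + 8 * (size l %/ 9) + 20),
    (2 * (size l %/ 9) <= count (fun x : R * R => (d <= x.1)%R) l)%N,
    (2 * (size l %/ 9) <= count (fun x : R * R => (x.1 <= d)%R) l)%N,
    (0 < count (fun x : R * R => (d <= x.1)%R) l)%N &
    (0 < count (fun x : R * R => (x.1 <= d)%R) l)%N].
Proof.
move=> IH l_gt0; move m_def: (med3s (med3s l)) => m.
have sz_m : size m = (size l %/ 9)%N by rewrite -m_def !size_med3s -divnMA.
have wm P : \sum_(x <- m | P x.1) x.2 = (count (P \o fst) m)%:R.
  by rewrite -m_def; exact: med3s_weights.
have ge_m d : (4 * count (fun x : R * R => (d <= x.1)%R) m <= count (fun x : R * R => (d <= x.1)%R) l)%N.
  have := count_med3s_ge d l; have := count_med3s_ge d (med3s l); rewrite m_def; lia.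
have le_m d : (4 * count (fun x : R * R => (x.1 <= d)%R) m <= count (fun x : R * R => (x.1 <= d)%R) l)%N.
  have := count_med3s_le d l; have := count_med3s_le d (med3s l); rewrite m_def; lia.
have [m0|m_gt0] := posnP (size m).
  rewrite (size0nil m0) -sz_m m0.
  case: l l_gt0 {IH ge_m le_m wm m0 m_def sz_m} => // -[k w] l _.
  exists k; split=> [env||||]; rewrite /= ?lexx //.
  by eapply evalb_le; [rewrite /pivot_expr; ev|lia].
(* The median of [m] is the selection with unit weights and capacity half of
   [size m]. *)
have wE : \sum_(x <- m) x.2 = (size m)%:R by rewrite (wm predT) count_predT.
have m_pos : 0 < (size m)%:R :> R by rewrite ltr0n.
have [|||d [ev_d]] := IH ((size m)%:R / 2%:R) m.
- by rewrite sz_m; lia.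
- move=> x; rewrite -m_def; elim/seq3_ind: (med3s l) => [[|? [|? [|? ?]]] //|x1 x2 x3 s IHs].
  by rewrite inE => /predU1P[-> /=|/IHs]; rewrite ?ler01.
- by rewrite wE; lra.
rewrite (wm (fun k => d < k)) (wm (fun k => d <= k)) => gt_d ge_d.
have {}gt_d : (2 * count (fun x : R * R => (d < x.1)%R) m <= size m)%N.
  by rewrite -(ler_nat R) natrM; move: gt_d; rewrite /comp /=; lra.
have {}ge_d : (size m < 2 * count (fun x : R * R => (d <= x.1)%R) m)%N.
  by rewrite -(ltr_nat R) natrM; move: ge_d; rewrite /comp /=; lra.
have le_d : (count (fun x : R * R => (d < x.1)%R) m + count (fun x : R * R => (x.1 <= d)%R) m = size m)%N.
  rewrite -(count_predC (fun x => d < x.1)); congr (_ + _)%N.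
  by apply: eq_count => x /=; rewrite leNgt.
have le_l := le_m d; have ge_l := ge_m d; exists d; split=> [env||||]; try lia.
have wsm := wsum_spec m; rewrite wE in wsm.
have n2 : (2%:R == 0 :> R) = false by rewrite pnatr_eq0.
rewrite -sz_m; case: (m) m_gt0 ev_d wsm => // -[k w] m' _ ev_d wsm.
by eapply evalb_le; [rewrite /pivot_expr; ev|lia].
Qed.

(** The recurrence T(n) <= T(n %/ 9) + T(n - r) + 88 n + 150 with
    [r >= 2 * (n %/ 9)] and [r >= 1] is solved by [K * n]. If [n >= 9], the slack [K * (n %/ 9)] pays for
    the linear term, as [n <= 9 * (n %/ 9) + 8]; if [n < 9], the slack [K] does.
    No additive constant is lost, because the groups are rounded down. *)
Lemma sel_cost K n h r : (1700 <= K)%N -> (h + r = n)%N -> (2 * (n %/ 9) <= r)%N ->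
  (0 < r)%N -> (K * h + K * (n %/ 9) + 88 * n + 150 <= K * n)%N.
Proof.
move=> K_big hr r_big r_gt0; have [q0|q_gt0] := posnP (n %/ 9)%N.
  have [s nE] : exists s, n = (h + 1 + s)%N by exists (r - 1)%N; lia.
  by rewrite q0 nE; nia.
have := leq_mul K_big (leqnn (n %/ 9)%N); have := leq_mul (leqnn K) r_big.
have : (K * n = K * h + K * r)%N by rewrite -mulnDr hr.
lia.
Qed.

(** The pivot is the answer if the weight first exceeds [c] among the keys equal
    to it; otherwise the answer is that of one side. Repeated keys do no harm,
    since both sides exclude all copies of the pivot. *)
Lemma sel_spec K (c : R) l : (1700 <= K)%N ->
  nonneg l -> 0 <= c < \sum_(x <- l) x.2 ->
  exists d, [/\ evb [:: VCons (VNum c) (enc l)] sel_fun (VNum d) (K * size l),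
    \sum_(x <- l | d < x.1) x.2 <= c & c < \sum_(x <- l | d <= x.1) x.2].
Proof.
move=> K_big; have [n] := ubnP (size l); elim: n l c => // n IHn l c sz_l l0 /andP[c0 c_lt].
have IH (c' : R) l' : (size l' < size l)%N -> nonneg l' -> 0 <= c' < \sum_(x <- l') x.2 ->
     exists d, [/\ evb [:: VCons (VNum c') (enc l')] sel_fun (VNum d) (K * size l'),
       \sum_(x <- l' | d < x.1) x.2 <= c' & c' < \sum_(x <- l' | d <= x.1) x.2].
  by move=> lt_l'; apply: IHn; lia.
have l_gt0 : (0 < size l)%N.
  by case: l c_lt {sz_l l0 IH} => //; rewrite big_nil ltNge c0.
have [d [ev_d ge_d le_d ge1 le1]] := pivot_spec c IH l_gt0.
have szm1 : (size (med3s l) = size l %/ 3)%N by rewrite !size_med3s.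
have sz_hi : (size (above d l) + count (fun x : R * R => (x.1 <= d)%R) l = size l)%N.
  rewrite /above /below size_filter -(count_predC (fun x => d < x.1)); congr (_ + _)%N.
  by apply: eq_count => x /=; rewrite leNgt.
have sz_lo : (size (below d l) + count (fun x : R * R => (d <= x.1)%R) l = size l)%N.
  rewrite /above /below size_filter -(count_predC (fun x => x.1 < d)); congr (_ + _)%N.
  by apply: eq_count => x /=; rewrite leNgt.
case hi_c: (\sum_(x <- above d l) x.2 <= c); last first.
  have c_hi : c < \sum_(x <- above d l) x.2 by rewrite ltNge hi_c.
  have [||| d' [ev_d' gt_d' ge_d']] := IH c (above d l).
  - by lia.
  - by apply: nonneg_filter.
  - by rewrite c0.
  rewrite /above !big_filter_cond in gt_d' ge_d'; rewrite /above big_filter in c_hi.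
  have /andP[] := above_cut l0 c_hi gt_d' ge_d'.
  exists d'; split=> //; eapply evalb_le.
    rewrite /sel_fun; eapply evalb_match; [ev|].
    eapply evalb_let; [ev|]; eapply evalb_let; [exact: ev_d|]; ev.
  have := sel_cost K_big sz_hi le_d le1; rewrite szm1; lia.
have [g_c|c_g] := lerP (\sum_(x <- l) x.2 - \sum_(x <- below d l) x.2) c; last first.
  exists d; split; last first.
  - move: c_g; rewrite /below big_filter (bigID (fun x => x.1 < d)) /= addrC addrK.
    by under eq_bigl => x do rewrite -leNgt.
  - by move: hi_c; rewrite /above big_filter.
  have {}c_g : (\sum_(x <- l) x.2 - \sum_(x <- below d l) x.2 <= c) = false.
    by rewrite leNgt c_g.
  eapply evalb_le.
    rewrite /sel_fun; eapply evalb_match; [ev|].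
    eapply evalb_let; [ev|]; eapply evalb_let; [exact: ev_d|]; ev.
  have := sel_cost K_big sz_hi le_d le1; rewrite szm1; lia.
have [||| d' [ev_d' gt_d' ge_d']] :=
  IH (c - (\sum_(x <- l) x.2 - \sum_(x <- below d l) x.2)) (below d l).
- by lia.
- by apply: nonneg_filter.
- by rewrite subr_ge0 g_c /=; lra.
have g_c' : (\sum_(x <- l) x.2 - \sum_(x <- below d l) x.2 <= c) = true by [].
have /andP[] : \sum_(x <- l | d' < x.1) x.2 <= c < \sum_(x <- l | d' <= x.1) x.2.
  rewrite /below big_filter in gt_d' ge_d' g_c; rewrite !big_filter_cond in gt_d' ge_d'.
  exact: (@below_cut d).
exists d'; split=> //; eapply evalb_le.
  rewrite /sel_fun; eapply evalb_match; [ev|].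
  eapply evalb_let; [ev|]; eapply evalb_let; [exact: ev_d|]; ev.
have := sel_cost K_big sz_lo ge_d ge1; rewrite szm1; lia.
Qed.

End Specs.

(** * The greedy solution for one capacity *)

Section Greedy.
Variables (R : realFieldType) (T : eqType) (p s : T -> R) (m : T -> bool).
Implicit Types (l : seq T) (lam r F : R).

(** Items of size 0 have no density; they are taken anyway and do not affect the
    weights among which the threshold is selected. *)
Definition cands l : seq (R * R) := [seq (p i / s i, s i) | i <- l & ~~ (s i <= 0)].

Definition excess lam l : R :=
  \sum_(i <- l) (if p i <= lam * s i then 0 else p i - lam * s i).

(** The empty sequence signals that no item has profit above [F / 2]; on an empty
    instance [fill] then returns the empty sequence as well. *)
Fixpoint single F l : bitseq :=
  if l is i :: l' then
    if p i + p i <= F then (if single F l' is [::] then [::] else false :: single F l')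
    else true :: nseq (size l') false
  else [::].

(** Items of density above [lam] are taken without a test: [r] is the capacity
    that remains after all of them, and is only spent on items of density [lam].
    Comparing [p i] with [lam * s i] handles size 0 uniformly. *)
Fixpoint fill lam r l : bitseq :=
  if l is i :: l' then
    if p i <= lam * s i then
      if lam * s i <= p i then
        if s i <= r then true :: fill lam (r - s i) l' else false :: fill lam r l'
      else false :: fill lam r l'
    else true :: fill lam r l'
  else [::].

Definition enc_item (i : T) : value R :=
  VCons (VNum (p i)) (VCons (VNum (s i)) (VNum (m i)%:R)).

Definition enc_out (b : bitseq) l : value R :=
  vlist [seq vlist [:: VNum x.1%:R; VNum (x.1 && m x.2)%:R] | x : bool * T <- zip b l].

Local Notation evb := (evalb (R := R) knap_funs).
Local Notation encl l := (vlist (map enc_item l)).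
Local Notation encp l := (vlist (map (@enc_pair R) l)).

Lemma cands_spec l : evb [:: encl l] cands_fun (encp (cands l)) (20 * size l + 10).
Proof.
elim: l => [|i l IH]; first by eapply evalb_le; [rewrite /cands_fun; ev|].
rewrite /cands /=; case s0: (s i <= 0) => /=; rewrite -/(cands l).
  by eapply evalb_le; [rewrite /cands_fun; ev; cbn [enc_item]; ev|lia].
have sn0 : (s i == 0) = false by apply/negbTE/eqP => e; move: s0; rewrite e lexx.
by eapply evalb_le; [rewrite /cands_fun; ev; cbn [enc_item]; ev|lia].
Qed.

Lemma excess_spec lam l :
  evb [:: VCons (VNum lam) (encl l)] excess_fun (VNum (excess lam l)) (30 * size l + 10).
Proof.
elim: l => [|i l IH].
  by rewrite /excess big_nil; eapply evalb_le; [rewrite /excess_fun; ev|].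
rewrite /excess big_cons -/(excess lam l); case c: (p i <= lam * s i) => /=;
  by (eapply evalb_le; [rewrite /excess_fun; ev; cbn [enc_item]; ev|lia]).
Qed.

Lemma zeros_spec l :
  evb [:: encl l] zeros_fun (enc_out (nseq (size l) false) l) (20 * size l + 10).
Proof.
elim: l => [|i l IH]; first by eapply evalb_le; [rewrite /zeros_fun; ev|].
by rewrite /enc_out /= -/(enc_out _ _); eapply evalb_le; [rewrite /zeros_fun /out0; ev|lia].
Qed.

Hint Resolve zeros_spec : evaldb.

Lemma single_spec F l :
  evb [:: VCons (VNum F) (encl l)] single_fun (enc_out (single F l) l) (40 * size l + 10).
Proof.
elim: l => [|i l IH]; first by eapply evalb_le; [rewrite /single_fun; ev|].
rewrite /=; case c: (p i + p i <= F).
  case e: (single F l) IH => [|b bs] IH.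
    have out_nil : enc_out [::] l = VNil by rewrite /enc_out; case: (l).
    rewrite out_nil in IH.
    by eapply evalb_le; [rewrite /single_fun; ev; cbn [enc_item]; ev|lia].
  case: l e IH => // j l e IH.
  rewrite /enc_out /= in IH *.
  eapply evalb_le; [rewrite /single_fun /out0; ev; cbn [enc_item]; ev|lia].
by rewrite /enc_out /= -/(enc_out _ _);
  eapply evalb_le; [rewrite /single_fun; ev; cbn [enc_item]; ev|lia].
Qed.

Lemma fill_spec lam r l :
  evb [:: VCons (VNum lam) (VCons (VNum r) (encl l))] fill_fun
      (enc_out (fill lam r l) l) (50 * size l + 10).
Proof.
elim: l r => [|i l IH] r; first by eapply evalb_le; [rewrite /fill_fun; ev|].
rewrite /=; case c1: (p i <= lam * s i); last first.
  by rewrite /enc_out /= -/(enc_out _ _);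
    eapply evalb_le; [rewrite /fill_fun /out0; cbv zeta beta; ev; cbn [enc_item]; ev|lia].
case c2: (lam * s i <= p i); last first.
  by rewrite /enc_out /= -/(enc_out _ _);
    eapply evalb_le; [rewrite /fill_fun /out0; cbv zeta beta; ev; cbn [enc_item]; ev|lia].
by case c3: (s i <= r); rewrite /enc_out /= -/(enc_out _ _);
  (eapply evalb_le; [rewrite /fill_fun /out0; cbv zeta beta; ev; cbn [enc_item]; ev|lia]).
Qed.

Lemma size_fill lam r l : size (fill lam r l) = size l.
Proof. by elim: l r => //= i l IH r; repeat case: ifP => _; rewrite /= IH. Qed.

(** Items of density [lam] contribute 0 to both sides, whichever of them fit. *)
Lemma fill_excess lam r l :
  \sum_(i <- mask (fill lam r l) l) (p i - lam * s i) = excess lam l.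
Proof.
rewrite /excess; elim: l r => [|i l IH] r; first by rewrite !big_nil.
rewrite big_cons /=; case: (lerP (p i) (lam * s i)) => [p_le|_]; last by rewrite /= big_cons IH.
case: (lerP (lam * s i) (p i)) => [le_p|_]; last by rewrite /= IH add0r.
have pE : p i = lam * s i by apply/eqP; rewrite eq_le p_le.
by case: ifP => _; rewrite /= ?big_cons IH ?pE ?subrr add0r.
Qed.

Hypothesis s_ge0 : forall i, 0 <= s i.

Lemma fill_le lam r l : 0 <= r ->
  \sum_(i <- mask (fill lam r l) l) s i <= \sum_(i <- l | lam * s i < p i) s i + r.
Proof.
elim: l r => [|i l IH] r r0; first by rewrite !big_nil add0r.
rewrite /= big_cons; case: (lerP (p i) (lam * s i)) => [p_le|_]; last first.
  by rewrite /= big_cons -addrA lerD2l; apply: IH.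
case: ifP => _; last exact: IH.
case: (lerP (s i) r) => s_r; last exact: IH.
have := IH (r - s i); rewrite subr_ge0 s_r => /(_ isT) /=; rewrite big_cons; lra.
Qed.

Lemma fill_ge lam r l :
  \sum_(i <- l | lam * s i < p i) s i <= \sum_(i <- mask (fill lam r l) l) s i.
Proof.
elim: l r => [|i l IH] r; first by rewrite !big_nil.
rewrite /= big_cons; case: (lerP (p i) (lam * s i)) => [p_le|_]; last first.
  by rewrite /= big_cons lerD2l; apply: IH.
case: ifP => _; last exact: IH.
case: (lerP (s i) r) => s_r; last exact: IH.
have := IH (r - s i); have := s_ge0 i; rewrite /= big_cons; lra.
Qed.

(** If an item of density [lam] is rejected, the capacity left at that moment is
    less than its size, and the items that follow can only add to the used size
    what was reserved for them or more. *)
Lemma fill_maximal lam r l :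
  \sum_(i <- l | lam * s i <= p i) s i <= \sum_(i <- mask (fill lam r l) l) s i \/
  exists2 i, i \in l & p i = lam * s i /\
    \sum_(i <- l | lam * s i < p i) s i + r < \sum_(i <- mask (fill lam r l) l) s i + s i.
Proof.
elim: l r => [|i l IH] r; first by left; rewrite !big_nil.
rewrite /= !big_cons; case: (lerP (p i) (lam * s i)) => [p_le|lt_p]; last first.
  rewrite /= !big_cons (ltW lt_p).
  case: (IH r) => [?|[j jl [pj lt_j]]]; first by left; rewrite lerD2l.
  by right; exists j; rewrite ?inE ?jl ?orbT //; split => //; lra.
case: (lerP (lam * s i) (p i)) => [le_p|lt_p]; last first.
  case: (IH r) => [?|[j jl [pj lt_j]]]; first by left.
  by right; exists j; rewrite ?inE ?jl ?orbT.
case: (lerP (s i) r) => s_r /=; last first.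
  right; exists i; first by rewrite inE eqxx.
  split; first by apply/eqP; rewrite eq_le p_le.
  have := fill_ge lam r l; lra.
rewrite !big_cons; case: (IH (r - s i)) => [?|[j jl [pj lt_j]]].
  by left; rewrite lerD2l.
by right; exists j; rewrite ?inE ?jl ?orbT //; split => //; lra.
Qed.

Lemma singleP F l :
  (single F l = [::] /\ forall i, i \in l -> p i + p i <= F) \/
  exists2 i, i \in l &
    [/\ F < p i + p i, mask (single F l) l = [:: i] & size (single F l) = size l].
Proof.
elim: l => [|i l IH /=]; first by left.
case: lerP => [p_le|lt_p]; last first.
  right; exists i; first by rewrite inE eqxx.
  by split; rewrite //= ?size_nseq // mask_false.
case: IH => [[-> all_le]|[j jl [lt_j mask_j size_j]]].
  by left; split=> // j /predU1P[-> //|/all_le].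
right; exists j; first by rewrite inE jl orbT.
by case: (single F l) mask_j size_j => [|b bs] //= -> ->; split.
Qed.

(** The extra pair [(0, 2)] ensures that the total weight exceeds the capacity 1,
    so that selection always has an answer; it has key 0, so the answer 0 means
    that the items of positive density fit. *)
Lemma weight_cands lam l : 0 <= lam ->
  \sum_(x <- (0, 2%:R) :: cands l | lam < x.1) x.2 = \sum_(i <- l | lam * s i < p i) s i.
Proof.
move=> lam0; rewrite big_cons /= ltNge lam0 /= /cands big_map big_filter_cond.
rewrite big_mkcond [RHS]big_mkcond; apply: eq_bigr => i _ /=.
case: (lerP (s i) 0) => [s_le|s_gt] /=; last by rewrite ltr_pdivlMr.
by have -> : s i = 0 by [apply/eqP; rewrite eq_le s_le s_ge0]; case: ifP.
Qed.

Lemma weight_cands_ge lam l : 0 < lam ->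
  \sum_(x <- (0, 2%:R) :: cands l | lam <= x.1) x.2 <= \sum_(i <- l | lam * s i <= p i) s i.
Proof.
move=> lam0; rewrite big_cons /= (lt_geF lam0) /cands big_map big_filter_cond.
rewrite big_mkcond [leRHS]big_mkcond; apply: ler_sum => i _ /=.
case: (lerP (s i) 0) => [s_le|s_gt] /=; last by rewrite ler_pdivlMr.
by case: ifP.
Qed.

Lemma excess_ge0 lam l : 0 <= excess lam l.
Proof. by apply: sumr_ge0 => i _; case: (lerP (p i) (lam * s i)) => // /ltW; rewrite subr_ge0. Qed.

(** Weak duality: pricing size at [lam], no set of items gains more than the sum of
    the positive parts. *)
Lemma excess_bound lam l b : 0 <= lam ->
  \sum_(i <- mask b l) p i <= excess lam l + lam * \sum_(i <- mask b l) s i.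
Proof.
move=> lam0; elim: l b => [|i l IH] [|[] b]; rewrite /= ?big_nil ?mulr0 ?addr0 ?excess_ge0 //.
  have := IH b; rewrite /excess !big_cons -/(excess lam l); case: (lerP (p i) (lam * s i)); lra.
have := IH b; rewrite /excess !big_cons -/(excess lam l); case: (lerP (p i) (lam * s i)); lra.
Qed.

End Greedy.

(** * Shares of the budgets and the reduction to one capacity *)

Section Share.
Variable R : realFieldType.
Implicit Types a b : R.

(** An item that exceeds a budget is given the share 3: two shares that fit sum
    to at most 2, so a size of at most 2 tells that the item fits. *)
Definition share a b : R := if a <= b then a / b else 3.

(** For [b = 0] the program cannot divide; the only [a] that fits is 0, and the
    convention [a / 0 = 0] makes the share 0, as it should be. *)
Lemma share_spec a b : 0 <= b -> 0 <= a ->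
  evalb knap_funs [:: VCons (VNum a) (VNum b)] share_fun (VNum (share a b)) 20.
Proof.
move=> b0 a0; rewrite /share /share_fun.
case ab: (a <= b); last by eapply evalb_le; [ev|].
case b_le0: (b <= 0).
  have bE : b = 0 by apply: le_anti; rewrite b_le0 b0.
  have e0 : (0 <= (0%N%:R : R)) = true by rewrite lexx.
  by move: ab; rewrite bE invr0 mulr0 => ab; eapply evalb_le; [ev|].
have bn0 : (b == 0) = false by apply/negbTE; rewrite gt_eqF // ltNge b_le0.
by eapply evalb_le; [ev|].
Qed.

Lemma share_ge0 a b : 0 <= a -> 0 <= b -> 0 <= share a b.
Proof. by move=> a0 b0; rewrite /share; case: ifP => _ //; rewrite divr_ge0. Qed.

Lemma share_le1 a b : 0 <= a -> a <= b -> share a b <= 1.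
Proof.
move=> a0 ab; rewrite /share ab; have [b0|b0] := lerP b 0; last by rewrite ler_pdivrMr ?mul1r.
have -> : b = 0 by apply: le_anti; rewrite b0 (le_trans a0 ab).
by rewrite invr0 mulr0.
Qed.

Lemma share_le2 a b : share a b <= 2 -> a <= b.
Proof. by rewrite /share; case: (lerP a b) => // _ le2; exfalso; lra. Qed.

Lemma shareK a b : 0 <= a -> a <= b -> share a b * b = a.
Proof.
move=> a0 ab; rewrite /share ab; have [b0|b0] := eqVneq b 0; last by rewrite divfK.
by rewrite b0 mulr0 in ab *; apply: le_anti; rewrite a0 ab.
Qed.

Lemma share0 b : 0 <= b -> share 0 b = 0.
Proof. by move=> b0; rewrite /share b0 mul0r. Qed.

Lemma sum_le_of_share (T : eqType) (S : seq T) (a : T -> R) b : 0 <= b ->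
  (forall i, i \in S -> 0 <= a i <= b) ->
  \sum_(i <- S) share (a i) b <= 1 -> \sum_(i <- S) a i <= b.
Proof.
move=> b0 ab sum_le1; have -> : \sum_(i <- S) a i = (\sum_(i <- S) share (a i) b) * b.
  rewrite mulr_suml big_seq [RHS]big_seq; apply: eq_bigr => i /ab /andP[a0 a_b].
  by rewrite shareK.
by rewrite -[leRHS]mul1r ler_wpM2r.
Qed.

Lemma sum_share_le1 (T : finType) (a : T -> R) b : 0 <= b ->
  (forall i, 0 <= a i) -> \sum_i a i <= b -> \sum_i share (a i) b <= 1.
Proof.
move=> b0 a0 sum_a; have a_le i : a i <= b.
  apply: le_trans sum_a; rewrite (bigD1 i) //= lerDl; exact: sumr_ge0.
rewrite (eq_bigr (fun i => a i / b)) => [|i _]; last by rewrite /share a_le.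
rewrite -mulr_suml; have [b_le|b_gt] := lerP b 0; last by rewrite ler_pdivrMr ?mul1r.
have -> : b = 0 by apply: le_anti; rewrite b_le b0.
by rewrite invr0 mulr0.
Qed.

End Share.

Section Instance.
Variables (R : realFieldType) (n : nat) (I : iKds R n).
Local Notation B := (kbudget I).
Local Notation C := (ibudget I).
Implicit Types (x y : {ffun 'I_n -> bool}) (b : bitseq).

Definition plain_size i := share (wgt I i) B.
Definition improved_size i := share (iwgt I i) B + share (icost I i) C.
Definition improves i := ~~ (plain_size i <= improved_size i).
Definition isize i := if improves i then improved_size i else plain_size i.
(** An item that fits in no way gets profit 0 and has size at least 3, hence is
    never taken. *)
Definition iprofit i := if isize i <= 2%:R then prof I i else 0.

Local Notation evb := (evalb (R := R) knap_funs).
Local Notation items l := (vlist (map (enc_item iprofit isize improves) l)).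
Local Notation B0 := (kbudget_ge0 I).
Local Notation C0 := (ibudget_ge0 I).

Let w0 i : 0 <= wgt I i. Proof. by case/andP: (iwgt_bounds I i) => /le_trans; apply. Qed.
Let iw0 i : 0 <= iwgt I i. Proof. by case/andP: (iwgt_bounds I i). Qed.

Lemma isize_ge0 i : 0 <= isize i.
Proof.
by rewrite /isize; case: ifP => _; rewrite ?addr_ge0 ?share_ge0 ?B0 ?C0 ?icost_ge0.
Qed.

Lemma prep_spec l :
  evb [:: VCons (VNum B) (VCons (VNum C) (vlist (map (encode_item I) l)))] prep_fun
      (items l) (200 * size l + 10).
Proof.
elim: l => [|i l IH]; first by eapply evalb_le; [rewrite /prep_fun; ev|].
have sh1 := share_spec B0 (w0 i); have sh2 := share_spec B0 (iw0 i).
have sh3 := share_spec C0 (icost_ge0 I i).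
rewrite /= /enc_item /iprofit /isize /improves.
case c1: (plain_size i <= improved_size i) => /=.
  case c2: (plain_size i <= 2%:R); rewrite /plain_size /improved_size in c1 c2 *;
  by (eapply evalb_le; [rewrite /prep_fun; ev; cbn [encode_item vlist foldr]; ev|lia]).
case c2: (improved_size i <= 2%:R); rewrite /plain_size /improved_size in c1 c2 *;
  by (eapply evalb_le; [rewrite /prep_fun; ev; cbn [encode_item vlist foldr]; ev|lia]).
Qed.

Definition picked b : {ffun 'I_n -> bool} := [ffun i : 'I_n => nth false b i].
Definition improved b : {ffun 'I_n -> bool} := [ffun i => picked b i && improves i].

Lemma sum_picked b (F : 'I_n -> R) : size b = n ->
  \sum_i F i * (picked b i)%:R = \sum_(i <- mask b (enum 'I_n)) F i.
Proof.
move=> sz_b; have -> : mask b (enum 'I_n) = [seq i <- enum 'I_n | picked b i].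
  rewrite filter_mask; congr mask.
  apply: (@eq_from_nth _ false) => [|k k_lt]; first by rewrite size_map size_enum_ord.
  have kn : (k < n)%N by rewrite -sz_b.
  by rewrite (nth_map (Ordinal kn)) ?size_enum_ord // ffunE nth_enum_ord.
rewrite big_filter [RHS]big_mkcond big_enum /=; apply: eq_bigr => i _.
by case: (picked b i); rewrite ?mulr1 ?mulr0.
Qed.

Lemma encode_picked b : size b = n ->
  encode_solution R (picked b) (improved b) = enc_out R improves b (enum 'I_n).
Proof.
move=> sz_b; rewrite /encode_solution /enc_out; congr vlist.
have sz_z : size (zip b (enum 'I_n)) = n by rewrite size_zip size_enum_ord sz_b minnn.
apply: (@eq_from_nth _ VNil) => [|k].
  by rewrite size_map size_enum_ord size_map sz_z.
rewrite size_map size_enum_ord => kn.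
rewrite (nth_map (Ordinal kn)) ?size_enum_ord // (nth_map (false, Ordinal kn)) ?sz_z //.
by rewrite nth_zip ?size_enum_ord // !ffunE nth_enum_ord.
Qed.

(** A set of total size at most 1 uses at most the whole of each budget; a single
    item only needs to fit by itself. *)
Lemma picked_ok b (S := mask b (enum 'I_n)) : size b = n ->
  (forall i, i \in S -> isize i <= 2%:R) ->
  \sum_(i <- S) isize i <= 1 \/ (exists i, S = [:: i]) ->
  feasible I (picked b) (improved b) /\ profit I (picked b) = \sum_(i <- S) iprofit i.
Proof.
move=> sz_b small_S S_ok.
pose u i := if improves i then iwgt I i else wgt I i.
pose v i := if improves i then icost I i else 0.
have uv i : isize i = share (u i) B + share (v i) C.
  by rewrite /isize /u /v; case: ifP => _; rewrite // share0 ?C0 ?addr0.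
have u0 i : 0 <= u i by rewrite /u; case: ifP.
have v0 i : 0 <= v i by rewrite /v; case: ifP; rewrite ?icost_ge0.
have sB i : 0 <= share (u i) B by apply: share_ge0; rewrite ?B0.
have sC i : 0 <= share (v i) C by apply: share_ge0; rewrite ?C0.
have u_le i : i \in S -> u i <= B.
  by move=> /small_S; rewrite uv => le2; apply: share_le2; have := sC i; lra.
have v_le i : i \in S -> v i <= C.
  by move=> /small_S; rewrite uv => le2; apply: share_le2; have := sB i; lra.
split; last first.
  rewrite /profit sum_picked // big_seq [RHS]big_seq; apply: eq_bigr => i iS.
  by rewrite /iprofit small_S.
have [u_sum v_sum] : \sum_(i <- S) u i <= B /\ \sum_(i <- S) v i <= C.
  case: S_ok => [sum_le1|[i Si]]; last first.
    by rewrite Si !big_seq1; split; [apply: u_le|apply: v_le]; rewrite Si inE.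
  have le1 : \sum_(i <- S) share (u i) B + \sum_(i <- S) share (v i) C <= 1.
    by rewrite -big_split /=; under eq_bigr => i _ do rewrite -uv.
  have B1 : 0 <= \sum_(i <- S) share (u i) B by apply: sumr_ge0.
  have C1 : 0 <= \sum_(i <- S) share (v i) C by apply: sumr_ge0.
  split.
    apply: (sum_le_of_share (a := u) B0) => [i iS|]; last by lra.
    by rewrite u0 u_le.
  apply: (sum_le_of_share (a := v) C0) => [i iS|]; last by lra.
  by rewrite v0 v_le.
apply/and3P; split.
- apply: le_trans u_sum; rewrite -sum_picked // -sumrB; apply: ler_sum => i _.
  rewrite [improved b i]ffunE /weight_gain /u.
  by case: (picked b i); case: (improves i) => /=; lra.
- apply: le_trans v_sum; rewrite -sum_picked //; apply: ler_sum => i _.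
  by rewrite [improved b i]ffunE /v; case: (picked b i); case: (improves i) => /=; lra.
- by apply/forallP => i; rewrite [improved b i]ffunE; case: (picked b i); case: (improves i).
Qed.

(** A feasible solution spends each budget at most once, so its sizes, which are at
    most the shares it uses, sum to at most 2; weak duality applies. *)
Lemma opt_le lam : 0 <= lam ->
  opt I <= excess iprofit isize lam (enum 'I_n) + lam * 2%:R.
Proof.
move=> lam0; apply: bigmax_le => [|[x y] /= /and3P[weight_le cost_le /forallP yx]].
  by rewrite addr_ge0 ?excess_ge0 ?mulr_ge0.
pose U i := wgt I i * (x i)%:R - weight_gain I i * (y i)%:R.
pose V i := icost I i * (y i)%:R.
have UE i : U i = if y i then iwgt I i else if x i then wgt I i else 0.
  by have := yx i; rewrite /U /weight_gain; case: (x i); case: (y i) => //= _; ring.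
have VE i : V i = if y i then icost I i else 0.
  by rewrite /V; case: (y i); rewrite ?mulr1 ?mulr0.
have U0 i : 0 <= U i by rewrite UE; do 2?case: ifP.
have V0 i : 0 <= V i by rewrite VE; case: ifP => // _; apply: icost_ge0.
have {}weight_le : \sum_i U i <= B by rewrite sumrB.
have {}cost_le : \sum_i V i <= C by [].
have U_le i : U i <= B.
  by apply: le_trans weight_le; rewrite (bigD1 i) //= lerDl; apply: sumr_ge0.
have V_le i : V i <= C.
  by apply: le_trans cost_le; rewrite (bigD1 i) //= lerDl; apply: sumr_ge0.
have size_le i : isize i * (x i)%:R <= share (U i) B + share (V i) C.
  have := isize_ge0 i; have : 0 <= share (U i) B by rewrite share_ge0 ?B0.
  have : 0 <= share (V i) C by rewrite share_ge0 ?C0.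
  have := yx i; rewrite UE VE /isize /improves; case: (x i) => [_|_]; last first.
    by rewrite mulr0 => *; apply: addr_ge0.
  rewrite mulr1; case: (y i) => /=.
    by rewrite -/(improved_size i); case: (lerP (plain_size i) (improved_size i)) => /=; lra.
  by rewrite -/(plain_size i); case: (lerP (plain_size i) (improved_size i)) => /=; lra.
have sizes_le : \sum_i isize i * (x i)%:R <= 2%:R.
  apply: (le_trans (ler_sum _ (fun i _ => size_le i))); rewrite big_split /=.
  have := sum_share_le1 B0 U0 weight_le; have := sum_share_le1 C0 V0 cost_le; lra.
pose b := [seq x i | i <- enum 'I_n].
have sz_b : size b = n by rewrite size_map size_enum_ord.
have bx i : picked b i = x i.
  by rewrite ffunE (nth_map i) ?size_enum_ord // nth_ord_enum.
have -> : profit I x = \sum_(i <- mask b (enum 'I_n)) iprofit i.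
  rewrite -sum_picked //; apply: eq_bigr => i _; rewrite bx /iprofit.
  have := size_le i; have := share_le1 (U0 i) (U_le i); have := share_le1 (V0 i) (V_le i).
  by case: (x i); rewrite ?mulr0 // !mulr1; case: (lerP (isize i) 2%:R) => //; lra.
apply: (le_trans (excess_bound _ isize _ _ lam0)); rewrite lerD2l ler_wpM2l //.
by rewrite -sum_picked //; under eq_bigr => i _ do rewrite bx.
Qed.

End Instance.

(** * The algorithm *)

(** The run of the whole program, and what selection says about the threshold,
    restated for the items rather than for the keys: the threshold 0 needs no
    lower bound, and a positive one is not reached by the extra key. *)
Lemma main_spec (R : realFieldType) (n : nat) (I : iKds R n) :
  exists2 lam : R,
    [/\ 0 <= lam,
        \sum_(i <- enum 'I_n | lam * isize I i < iprofit I i) isize I i <= 1 &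
        lam = 0 \/ 1 < \sum_(i <- enum 'I_n | lam * isize I i <= iprofit I i) isize I i] &
    let F := lam + excess (iprofit I) (isize I) lam (enum 'I_n) in
    let sg := single (iprofit I) F (enum 'I_n) in
    let r := 1 - \sum_(i <- enum 'I_n | lam * isize I i < iprofit I i) isize I i in
    evalb knap_funs [:: encode_instance I] main_expr
      (enc_out R (improves I)
        (if sg is [::] then fill (iprofit I) (isize I) lam r (enum 'I_n) else sg) (enum 'I_n))
      (4000 * n.+1).
Proof.
set l := enum 'I_n; set p := iprofit I; set s := isize I.
have s0 i : 0 <= s i by apply: isize_ge0.
set cs := (0, 2%:R) :: cands p s l.
have cs0 : nonneg cs.
  move=> x /predU1P[-> //|/mapP[i _ ->]]; exact: s0.
have cs_gt1 : (0 : R) <= 1 < \sum_(x <- cs) x.2.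
  rewrite ler01 big_cons /=; have : 0 <= \sum_(x <- cands p s l) x.2.
    by rewrite big_seq; apply: sumr_ge0 => x x_in; apply: cs0; rewrite inE x_in orbT.
  lra.
have [lam [ev_lam gt_lam ge_lam]] := @sel_spec R 1700 1 cs (leqnn _) cs0 cs_gt1.
have lam0 : 0 <= lam.
  rewrite leNgt; apply/negP => lam_lt; move: gt_lam; apply/negP; rewrite -ltNge.
  rewrite big_cons /= lam_lt; apply: (@lt_le_trans _ _ 2%:R); first by rewrite ltr1n.
  rewrite lerDl big_seq_cond; apply: sumr_ge0 => x /andP[x_in _]; apply: cs0.
  by rewrite inE x_in orbT.
exists lam.
  rewrite -(weight_cands p s0 l lam0); split=> //.
  have [->|lam_gt0] := eqVneq lam 0; [by left|right].
  by apply: lt_le_trans ge_lam _; apply: weight_cands_ge; rewrite // lt0r lam_gt0.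
move=> F sg r.
have rE : r = 1 - \sum_(x <- above lam cs) x.2.
  by rewrite /above big_filter weight_cands.
have sz_l : size l = n by rewrite size_enum_ord.
have sz_cs : (size cs <= n.+1)%N.
  by rewrite /= ltnS size_map size_filter -[leqRHS]sz_l count_size.
have sz_above : (size (above lam cs) <= n.+1)%N.
  by apply: leq_trans sz_cs; rewrite size_filter count_size.
have ev_prep := prep_spec I l; have ev_cands := cands_spec p s (improves I) l.
have ev_excess := excess_spec p s (improves I) lam l.
have ev_single := single_spec p s (improves I) F l.
have ev_fill := fill_spec p s (improves I) lam r l.
have ev_above := above_spec lam cs; have ev_wsum := wsum_spec (above lam cs).
rewrite rE in ev_fill; rewrite rE -/sg.
have out_nil : enc_out R (improves I) [::] l = VNil by rewrite /enc_out; case: (l).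
have sz_sg : sg = [::] \/ size sg = size l.
  by case: (singleP p F l) => [[]|[i _ []]]; [left|right].
case sgE: sg sz_sg => [|b bs] sz_sg.
  rewrite /sg in sgE; rewrite sgE out_nil in ev_single.
  eapply evalb_le; first by rewrite /main_expr /encode_instance; ev.
  move: (size l) (size cs) (size (above lam cs)) sz_l sz_cs sz_above => n1 n2 n3; lia.
have [i [l' lE]] : exists i l', l = i :: l'.
  by case: (l) sz_sg => [|i l'] [] // _; exists i, l'.
rewrite -/sg sgE in ev_single.
have outE : exists u v, enc_out R (improves I) (b :: bs) l = VCons u v.
  by rewrite lE /enc_out /=; do 2!eexists.
have [u [v uvE]] := outE; rewrite uvE in ev_single *.
eapply evalb_le; first by rewrite /main_expr /encode_instance; ev.
move: (size l) (size cs) (size (above lam cs)) sz_l sz_cs sz_above => n1 n2 n3; lia.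
Qed.

Theorem theorem4p1 :
  exists (A : program) (K : nat),
  forall (R : realFieldType) (n : nat) (I : iKds R n),
  exists (x y : {ffun 'I_n -> bool}) (t : nat),
    [/\ runs A (encode_instance I) (encode_solution R x y) t,
        (t <= K * n.+1)%N,
        feasible I x y
      & 1 / 6 * opt I <= profit I x].
Proof.
exists (Program knap_funs main_expr), 4000 => R n I.
have [lam [lam0 gt_lam ge_lam]] := main_spec I.
set l := enum 'I_n; set p := iprofit I; set s := isize I; cbv zeta.
set F := lam + _; set r := 1 - _; move=> ev_main.
have s0 i : 0 <= s i by apply: isize_ge0.
have opt_F : opt I <= 2%:R * F.
  apply: le_trans (opt_le I lam0) _; have := excess_ge0 p s lam l.
  rewrite /F -/p -/s -/l; lra.
(* Both solutions are compared with the optimum through [F <= 2 * profit]. *)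
have finish b : size b = n -> enc_out R (improves I) b l =
    enc_out R (improves I) (if single p F l is [::] then fill p s lam r l else single p F l) l ->
    (forall i, i \in mask b l -> s i <= 2%:R) ->
    \sum_(i <- mask b l) s i <= 1 \/ (exists i, mask b l = [:: i]) ->
    F <= 2%:R * \sum_(i <- mask b l) p i ->
  exists (x y : {ffun 'I_n -> bool}) (t : nat),
    [/\ runs (Program knap_funs main_expr) (encode_instance I) (encode_solution R x y) t,
        (t <= 4000 * n.+1)%N, feasible I x y & 1 / 6 * opt I <= profit I x].
  move=> sz_b out_b small_b b_ok F_le; have [t ev_t t_le] := ev_main.
  have [feas prof_b] := picked_ok sz_b small_b b_ok.
  exists (picked n b), (improved I b), t; split=> //.
    by rewrite /runs /= encode_picked // out_b.
  rewrite prof_b -/p -/l; move: opt_F F_le; have : 0 <= opt I by apply: bigmax_ge_id.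
  lra.
have F0 : 0 <= F by rewrite addr_ge0 ?excess_ge0.
case: (singleP p F l) => [[sg_nil p_le]|[i _ [F_lt mask_i size_i]]]; last first.
  apply: (finish (single p F l)).
  - by rewrite size_i size_enum_ord.
  - by case: (single p F l) mask_i.
  - move=> j; rewrite mask_i inE => /eqP ->.
    move: F_lt; rewrite /p /iprofit -/s; case: ifP => // _; lra.
  - by right; exists i.
  - by rewrite mask_i big_seq1; lra.
have r0 : 0 <= r by rewrite subr_ge0.
have fill_le1 : \sum_(i <- mask (fill p s lam r l) l) s i <= 1.
  by have := fill_le p s lam l r0; rewrite {2}/r; lra.
apply: (finish (fill p s lam r l)).
- by rewrite size_fill size_enum_ord.
- by rewrite sg_nil.
- move=> i i_in; have : s i <= 1; last by lra.
  apply: le_trans fill_le1; rewrite (big_rem i) //= lerDl; exact: sumr_ge0.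
- by left.
have := fill_excess p s lam r l; rewrite sumrB -mulr_sumr => exE.
case: (fill_maximal p s0 lam r l) => [max_fill|[i i_in [p_i lt_i]]].
  have : lam <= lam * \sum_(i <- mask (fill p s lam r l) l) s i.
    case: ge_lam => [->|ge_lam]; first by rewrite mul0r.
    by rewrite ler_peMr // (le_trans (ltW ge_lam)).
  have := excess_ge0 p s lam l; rewrite /F; lra.
(* The rejected item [i] fills the capacity, and its profit is at most [F / 2]. *)
have : lam * 1 <= lam * (\sum_(i <- mask (fill p s lam r l) l) s i + s i).
  by rewrite ler_wpM2l //; apply/ltW; apply: le_lt_trans lt_i; rewrite /r addrC subrK.
by have := p_le i i_in; rewrite /F mulr1 mulrDr -p_i; lra.
Qed.
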